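(* Let $G$ be a connected conductance-weighted graph on $n$ vertices and let $x_v>0$ $(v\in V)$ be vertex weights. Then $$K_c(G;x)=\frac1{\tau_c(G)}\Bigg\{m\bigl(S_{c/x}(G),n-2\bigr)\prod_{v\in V}x_v+\sum_{C\in\mathcal C(G)}(-2)^{p(C)}\,c(C)\,m\bigl(S_{c/x}^{C}(G),n-2-|C|\bigr)\prod_{v\notin V(C)}x_v\Bigg\}.$$
   Context: $G=(V,E)$ is a finite connected simple undirected graph; each edge $e$ has a conductance $c_e\in\mathbb R_{>0}$. $\tau_c(G)=\sum_T\prod_{e\in T}c_e$, the sum over spanning trees $T$ of $G$. $r_c(u,v)$ is the effective resistance between $u$ and $v$ in the electrical network with edge conductances $c_e$. The doubly weighted Kirchhoff index is $$K_c(G;x)=\sum_{\{u,v\}\subseteq V}x_ux_v\,r_c(u,v),$$ summed over unordered pairs of distinct vertices. The weighted subdivision graph $S_{c/x}(G)$ has vertex set $V\sqcup\{e^*:e\in E\}$ and, for each $e\in E$ and each endpoint $v$ of $e$, an edge $ve^*$ of weight $c_e/x_v$. For a subgraph $C$ of $G$, $S(C)$ is its subdivision, with vertices $V(C)\cup\{e^*:e\in E(C)\}$, and $S_{c/x}^{C}(G):=S_{c/x}(G)-S(C)$ is obtained by deleting all vertices of $S(C)$ together with their incident edges. For an edge-weighted graph $H$, $m(H,j)$ is the total weight of its $j$-edge matchings, where the weight of a matching is the product of its edge weights ($m(H,0)=1$, and $m(H,j)=0$ for $j<0$). $\mathcal C(G)$ is the set of nonempty vertex-disjoint unions of cycles of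 $G$; for $C\in\mathcal C(G)$, $p(C)$ is its number of cycle components, $c(C)=\prod_{e\in E(C)}c_e$, and $|C|$ is its number of vertices (equal to its number of edges). *)

(* Defs.v *)
From mathcomp Require Import all_boot all_order all_algebra.
From mathcomp Require classical_sets.
Set Implicit Arguments.
Unset Strict Implicit.
Unset Printing Implicit Defensive.
Import Order.TTheory GRing.Theory Num.Theory.
Local Open Scope ring_scope.

(* A graph on the vertex type V is given by its set of edges, an edge being   *)
(* the set of its two endpoints; edge weights are functions on {set V}, of    *)
(* which only the values on edges matter.                                     *)

Section Graphs.
Variable V : finType.
Implicit Types (E C D T : {set {set V}}) (s : seq V).

Definition simple_graph E : Prop := forall e, e \in E -> #|e| = 2%N.

Definition adj E : rel V := [rel u v | [set u; v] \in E].

Definition connected_graph E : bool :=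
  [forall u, forall v, connect (adj E) u v].

Definition cycle_edges s : {set {set V}} := [set [set v; next s v] | v in s].

(* A sequence of distinct vertices has at most #|V| terms, so that the bound  *)
(* on the length of s is no restriction.                                      *)
Definition cycles E : {set {set {set V}}} :=
  [set D : {set {set V}} | (D \subset E) &&
    [exists s : #|V|.-bseq V,
      [&& uniq s, (2 < size s)%N & D == cycle_edges s]]].

Definition spanning_trees E : {set {set {set V}}} :=
  [set T : {set {set V}} |
    [&& T \subset E, connected_graph T & cycles T == set0]].

(* The set of nonempty vertex-disjoint unions of cycles of E. Since such a    *)
(* union C has no isolated vertex, it is determined by its edge set, and its  *)
(* vertex set is [cover C].                                                   *)
Definition cycle_unions E : {set {set {set V}}} :=
  [set C : {set {set V}} |
    [exists P : {set {set {set V}}},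
      [&& P != set0, P \subset cycles E,
          [forall D1 in P, forall D2 in P,
             (D1 != D2) ==> [disjoint cover D1 & cover D2]]
        & C == cover P]]].

Definition num_components C : nat := n_comp (adj C) (cover C).

Definition delete_vertices E (A : {set V}) : {set {set V}} :=
  [set e in E | [disjoint e & A]].

End Graphs.

Section Subdivision.
Variable V : finType.

(* In the subdivision, [inl v] is the vertex v and [inr e] the vertex e^*.    *)
Definition subdiv_vertices (U : {set V}) (E : {set {set V}}) :
    {set V + {set V}} :=
  [set inl v | v in U] :|: [set inr e | e in E].

Definition subdiv_edges (E : {set {set V}}) : {set {set V + {set V}}} :=
  [set [set inl v; inr e] | e in E, v in e].

(* See subdiv_weightE: for an edge of the subdivision both sums have exactly  *)
(* one term.                                                                  *)
Definition subdiv_weight (R : realFieldType) (c : {set V} -> R) (x : V -> R)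
    (f : {set V + {set V}}) : R :=
  \sum_(v : V | inl v \in f) \sum_(e : {set V} | inr e \in f) c e / x v.

Lemma subdiv_weightE (R : realFieldType) (c : {set V} -> R) (x : V -> R)
    (v : V) (e : {set V}) :
  subdiv_weight c x [set inl v; inr e] = c e / x v.
Proof.
rewrite /subdiv_weight (big_pred1 v) => [|u]; last by rewrite !inE orbF.
by rewrite (big_pred1 e) => [|d]; last by rewrite !inE.
Qed.

End Subdivision.

Section Weights.
Variable R : realFieldType.

Definition matching_weight (W : finType) (F : {set {set W}})
    (w : {set W} -> R) (j : int) : R :=
  \sum_(M : {set {set W}} | [&& M \subset F, trivIset M & #|M|%:Z == j])
    \prod_(f in M) w f.

Variable V : finType.
Implicit Types (E : {set {set V}}) (c : {set V} -> R).

Definition tree_weight E c : R :=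
  \sum_(T in spanning_trees E) \prod_(e in T) c e.

(* f is an electric potential when one unit of current enters the network at  *)
(* u and leaves it at v: by Ohm's law the current from w to an adjacent z is  *)
(* c_{wz} (f w - f z), and Kirchhoff's current law holds at each vertex w.    *)
Definition unit_current_potential E c (u v : V) (f : V -> R) : Prop :=
  forall w : V,
    \sum_(z | adj E w z) c [set w; z] * (f w - f z)
      = (w == u)%:R - (w == v)%:R.

(* The potential difference between u and v under such a unit current. On a   *)
(* connected network with positive conductances, the potential exists and is  *)
(* unique up to an additive constant.                                         *)
Definition effective_resistance E c (u v : V) : R :=
  classical_sets.xget 0
    (fun r : R => exists2 f, unit_current_potential E c u v f & r = f u - f v).

(* Each unordered pair of distinct vertices is counted once, in its order in  *)
(* the enumeration of V; the resistance is symmetric in u and v.              *)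
Definition kirchhoff_index E c (x : V -> R) : R :=
  \sum_(u : V) \sum_(v : V | (enum_rank u < enum_rank v)%N)
    x u * x v * effective_resistance E c u v.

End Weights.

(* Main.v *)
Require Import Defs.
From mathcomp Require Import all_boot all_order all_algebra.
From mathcomp Require Import perm.
From mathcomp Require classical_sets.
Import Order.TTheory GRing.Theory Num.Theory.
Local Open Scope ring_scope.

(* For a set W of vertices let L_W be the weighted Laplacian with the rows in *)
(* W replaced by those of the identity. By Cramer's rule and the matrix-tree  *)
(* theorem r(u, v) = det L_{u,v} / tau, so that tau K is the sum over         *)
(* two-element sets W of x^W det L_W.                                         *)
(* A row of the Laplacian outside W is a combination of vectors e_v - e_y, y  *)
(* ranging over the neighbours of v. By multilinearity det L_W is thus a sum  *)
(* over maps phi fixing W and sending every other vertex to a neighbour, with *)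
(* coefficients det (1 - A_phi), where A_phi is the matrix of phi off W. This *)
(* coefficient is 1 if every vertex is eventually sent to W and 0 otherwise,  *)
(* which gives the matrix-tree theorem; it is also the sum of (-1)^p over the *)
(* sets of p cycles of phi off W.                                             *)
(* Maps phi with a 2-cycle off W may hence be discarded. Exchanging the sums, *)
(* det L_W becomes a sum over disjoint unions C of directed cycles of length  *)
(* at least 3, of the total weight of maps without 2-cycle on the remaining   *)
(* vertices. Such a map is the same as the matching v -- {v, phi v}^* of the  *)
(* subdivision, and each undirected C has 2^p orientations.                   *)

Set Implicit Arguments.
Unset Strict Implicit.
Unset Printing Implicit Defensive.

(** Both sides of the formula, multiplied by the tree weight, become the same sum over maps from
    vertices to neighbours. On the electrical side, Cramer's rule ([effective_resistanceE]) and the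
    matrix-tree theorem ([tree_weightE]) give the sum of [x^W * det L_W] over two-element [W].
    [det_laplacian] expands each determinant over maps [phi], and [det_step_perm] writes the
    coefficient of [phi] as an alternating sum over sets of cycles of [phi], encoded as permutations
    [s]. [det_laplacian_perm] removes the maps with a 2-cycle, exchanges the sums and splits off
    [s], leaving a factor [no2weight] for the other vertices. On the combinatorial side, a matching
    of the subdivision joins each covered vertex [v] to some [{v, phi v}^*]; that no [e^*] is used
    twice means that [phi] has no 2-cycle. With [n - 2 - |C|] edges it misses exactly two vertices
    outside [C], and these form [W]. This is [matching_weight_no2]. Finally [sum_cycle_unions]
    passes from permutations to undirected unions of cycles: each has [2^p] orientations of sign
    [(-1)^p], whence [(-2)^p]. *)

(** * Determinants indexed by a finite type *)

Section PermTransport.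
Variables (T T' : finType) (f : T -> T') (g : T' -> T).
Hypotheses (fK : cancel f g) (gK : cancel g f).
Implicit Type s : {perm T}.

Lemma transport_inj s : injective (fun y => f (s (g y))).
Proof. exact: inj_comp (can_inj fK) (inj_comp perm_inj (can_inj gK)). Qed.

Definition perm_transport s : {perm T'} := perm (transport_inj (s := s)).

Lemma perm_transportE s y : perm_transport s y = f (s (g y)).
Proof. by rewrite permE. Qed.

Lemma porbit_transport s x : porbit (perm_transport s) (f x) = f @: porbit s x.
Proof.
have powE i : (perm_transport s ^+ i)%g (f x) = f ((s ^+ i)%g x).
  by elim: i => [|i IH]; rewrite ?expg0 ?perm1 // !expgSr !permM IH perm_transportE fK.
apply/setP=> y; apply/porbitP/imsetP=> [[i ->]|[z /porbitP[i ->] ->]].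
  by exists ((s ^+ i)%g x); rewrite ?mem_porbit ?powE.
by exists i; rewrite powE.
Qed.

Lemma odd_perm_transport s : perm_transport s = s :> bool.
Proof.
rewrite /odd_perm (bij_eq_card (Bijective gK fK)); congr (_ (+) odd _).
rewrite -(card_imset (porbits s) (imset_inj (can_inj fK))).
congr #|pred_of_set _|; apply/setP=> A; apply/imsetP/imsetP=> [[y _ ->]|[B]].
  exists (porbit s (g y)); first exact: imset_f.
  by rewrite -porbit_transport gK.
by case/imsetP=> x _ -> ->; exists (f x); rewrite ?porbit_transport.
Qed.

End PermTransport.

Section Determinants.
Variables (R : comNzRingType) (V : finType).
Implicit Types (m : V -> V -> R) (s : {perm V}).

Definition fmatrix m : 'M[R]_#|V| := \matrix_(i, j) m (enum_val i) (enum_val j).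

(** The library determinant sums over permutations of ordinals; relabelling along [enum_val]
    preserves parity ([odd_perm_transport]), which gives the Leibniz formula over permutations of
    [V]. *)
Lemma det_fmatrix m : \det (fmatrix m) = \sum_(s : {perm V}) (-1) ^+ s * \prod_v m v (s v).
Proof.
pose h := perm_transport (@enum_valK V) (@enum_rankK V).
pose h' := perm_transport (@enum_rankK V) (@enum_valK V).
have hK : cancel h h'.
  by move=> s; apply/permP=> i; rewrite !perm_transportE !enum_valK.
have h'K : cancel h' h.
  by move=> s; apply/permP=> i; rewrite !perm_transportE !enum_rankK.
rewrite (reindex h) /=; last by exists h' => s _; rewrite ?hK ?h'K.
apply: eq_bigr => s _; rewrite odd_perm_transport; congr (_ * _).
rewrite (reindex (@enum_val V V)) /=; last first.
  by apply: onW_bij; exists enum_rank; [exact: enum_valK | exact: enum_rankK].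
by apply: eq_bigr => i _; rewrite mxE perm_transportE enum_valK.
Qed.

(** In the Leibniz formula, each product of row sums distributes into a sum over choice functions
    [phi]. *)
Lemma det_multilinear (P : V -> pred V) (a : V -> V -> R)
    (b : V -> V -> V -> R) :
  \det (fmatrix (fun v z => \sum_(y | P v y) a v y * b v y z)) =
  \sum_(phi in family P)
     (\prod_v a v (phi v)) * \det (fmatrix (fun v => b v (phi v))).
Proof.
rewrite det_fmatrix; under eq_bigr do rewrite bigA_distr_big_dep mulr_sumr.
rewrite exchange_big; apply: eq_bigr => phi _ /=.
rewrite det_fmatrix mulr_sumr; apply: eq_bigr => s _.
by rewrite big_split /= mulrCA.
Qed.

Lemma fmatrix_mulv m (g : V -> R) :
  fmatrix m *m (\col_i g (enum_val i)) =
  \col_i \sum_z m (enum_val i) z * g z.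
Proof.
apply/matrixP=> i j; rewrite !mxE [RHS](reindex (@enum_val V V)) /=.
  by apply: eq_bigr => k _; rewrite !mxE.
by apply: onW_bij; exists enum_rank; [exact: enum_valK | exact: enum_rankK].
Qed.

End Determinants.

(** * Signs of permutations through their nontrivial cycles *)

Section CycleCount.
Variable V : finType.
Implicit Types (s : {perm V}).

(** Fixed points are left out, so that a permutation stands for a set of disjoint directed cycles,
    [ncycles] in number. *)
Definition moved s : {set V} := [set v | s v != v].
Definition ncycles s : nat := #|porbit s @: moved s|.

Lemma porbit_fix s v : v \notin moved s -> porbit s v = [set v].
Proof.
rewrite inE negbK => /eqP sv; apply/setP=> z; rewrite inE.
apply/porbitP/eqP=> [[i ->]|->]; last by exists 0; rewrite expg0 perm1.
by elim: i => [|i IH]; rewrite ?expg0 ?perm1 // expgSr permM IH.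
Qed.

Lemma moved_porbit s v z : z \in porbit s v -> (z \in moved s) = (v \in moved s).
Proof.
move=> zv; case: (boolP (v \in moved s)) => [vS|vS]; last first.
  by move: zv; rewrite porbit_fix // inE => /eqP ->; apply/negbTE.
apply: contraLR vS => zS; move: zv; rewrite porbit_sym porbit_fix // inE.
by move/eqP ->.
Qed.

Lemma card_porbits s : #|porbits s| = (ncycles s + (#|V| - #|moved s|))%N.
Proof.
have -> : porbits s = porbit s @: moved s :|: set1 @: ~: moved s.
  rewrite /porbits -(@eq_in_imset _ _ (porbit s) _ (mem (~: moved s))).
    rewrite -imsetU setUCr; apply/setP=> A.
    by apply/imsetP/imsetP=> -[v _ ->]; exists v.
  by move=> v; rewrite /= inE => /porbit_fix.
rewrite cardsU disjoint_setI0 ?cards0 ?subn0; last first.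
  rewrite -setI_eq0; apply/eqP/setP=> A; rewrite !inE; apply/negP.
  case/andP=> /imsetP[v vS ->] /imsetP[z]; rewrite in_setC => zS vz.
  by have := porbit_id s v; rewrite vz inE => /eqP vz'; rewrite -vz' vS in zS.
rewrite [X in (_ + X)%N]card_imset; last exact: set1_inj.
by congr (_ + _)%N; rewrite cardsCs setCK.
Qed.

(* A permutation of n points with p nontrivial cycles and m moved points has *)
(* p + (n - m) cycles in all, so its sign is (-1)^(p + m).                    *)
Lemma signr_ncycles (R : pzRingType) s :
  (-1) ^+ s * (-1) ^+ #|moved s| = (-1) ^+ ncycles s :> R.
Proof.
rewrite /odd_perm card_porbits oddD oddB ?max_card //.
rewrite -[_ ^+ #|_|]signr_odd -[RHS]signr_odd -signr_addb; congr (_ ^+ nat_of_bool _).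
by case: (odd #|V|) (odd (ncycles s)) (odd #|moved s|) => [] [] [].
Qed.

End CycleCount.

(** * Expansion of Laplacian determinants over maps to neighbours *)

Section Routings.
Variables (R : realFieldType) (V : finType) (E : {set {set V}}).
Variable c : {set V} -> R.
Hypothesis E_simple : simple_graph E.
Implicit Types (W : {set V}) (phi : {ffun V -> V}) (s : {perm V}).

Lemma adj_irr v : adj E v v = false.
Proof. by apply/negP=> /E_simple; rewrite setUid cards1. Qed.

Lemma adj_sym : symmetric (adj E).
Proof. by move=> u v; rewrite /adj /= setUC. Qed.

Lemma adj_neq u v : adj E u v -> u != v.
Proof. by apply: contraTneq => ->; rewrite adj_irr. Qed.

Definition routing W := family (fun v y => if v \in W then y == v else adj E v y).
Definition weight W phi : R := \prod_(v | v \notin W) c [set v; phi v].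
Definition rooted W phi := [forall v, exists z in W, fconnect phi v z].
(** The nontrivial cycles of such an [s] are cycles of [phi]: [s] encodes a set of cycles of
    [phi]. *)
Definition follows s phi := [forall v in moved s, s v == phi v].

Lemma routing_fix W phi v : phi \in routing W -> v \in W -> phi v = v.
Proof. by move/familyP/(_ v) => + vW; rewrite -topredE /= vW => /eqP. Qed.

Lemma routing_adj W phi v : phi \in routing W -> v \notin W -> adj E v (phi v).
Proof. by move/familyP/(_ v) => + /negbTE vW; rewrite -topredE /= vW. Qed.

Lemma rootedP W phi v : rooted W phi -> exists k, iter k phi v \in W.
Proof.
by move/forallP/(_ v)/exists_inP=> [z zW /iter_findex zE]; exists (findex phi v z);
  rewrite zE.
Qed.

Lemma rootedI W phi : (forall v, exists k, iter k phi v \in W) -> rooted W phi.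
Proof.
move=> h; apply/forallP=> v; have [k kW] := h v; apply/exists_inP.
by exists (iter k phi v) => //; apply: fconnect_iter.
Qed.

Definition laplacian W (v z : V) : R :=
  if v \in W then (v == z)%:R
  else \sum_(y | adj E v y) c [set v; y] * ((v == z)%:R - (y == z)%:R).

(** This is [1 - A_phi], where [A_phi] has zero rows on [W]. *)
Definition step W phi (v z : V) : R :=
  (v == z)%:R - ((v \notin W) && (phi v == z))%:R.

Lemma det_laplacian W :
  \det (fmatrix (laplacian W)) =
  \sum_(phi in routing W) weight W phi * \det (fmatrix (step W phi)).
Proof.
(* A row in [W] is treated as a one-term sum, with [y = v] and coefficient [1], so that
   multilinearity applies to all rows at once. *)
pose P v : pred V := fun y => if v \in W then y == v else adj E v y.
pose a v y := if v \in W then 1 else c [set v; y].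
pose b v y z : R := (v == z)%:R - ((v \notin W) && (y == z))%:R.
transitivity (\det (fmatrix (fun v z => \sum_(y | P v y) a v y * b v y z))).
  congr (\det _); apply/matrixP=> i j; rewrite !mxE /laplacian /P /a /b.
  case: ifP => _ //=; by rewrite big_pred1_eq subr0 mul1r.
rewrite det_multilinear; apply: eq_bigr => phi _; congr (_ * _).
rewrite (bigID (fun v => v \in W)) /= big1 ?mul1r => [|v vW]; last by rewrite /a vW.
by apply: eq_bigr => v /negbTE vW; rewrite /a vW.
Qed.

(** In the Leibniz sum a fixed vertex contributes the diagonal entry [1], since the graph has no
    loops, and a moved vertex contributes [-1] if [s v = phi v] and [0] otherwise. [signr_ncycles]
    then gives the sign. *)
Lemma det_step_perm W phi : phi \in routing W ->
  \det (fmatrix (step W phi)) = \sum_(s | follows s phi) (-1) ^+ ncycles s.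
Proof.
move=> phiW; rewrite det_fmatrix [RHS]big_mkcond; apply: eq_bigr => s _.
have fixE v : v \notin moved s -> step W phi v (s v) = 1.
  rewrite inE negbK /step => /eqP ->; rewrite eqxx.
  case: (boolP (v \in W)) => [_|/(routing_adj phiW)/adj_neq]; rewrite ?subr0 //=.
  by rewrite eq_sym => /negbTE ->; rewrite subr0.
case: ifPn => [/forall_inP sphi|].
  rewrite -signr_ncycles; congr (_ * _).
  rewrite -prodr_const [RHS]big_mkcond /=; apply: eq_bigr => v _.
  case: ifPn => [vS|/fixE //]; have := sphi v vS => /eqP svE.
  move: (vS); rewrite inE /step eq_sym => /negbTE ->.
  rewrite svE eqxx andbT sub0r; case: (boolP (v \in W)) => //= vW.
  by move: vS; rewrite inE svE (routing_fix phiW vW) eqxx.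
case/forall_inPn => v; rewrite inE => sv /negbTE sphi.
rewrite (bigD1 v) //= /step eq_sym (negbTE sv) [phi v == _]eq_sym sphi andbF.
by rewrite subr0 mul0r mulr0.
Qed.

(** On [moved s] the map [phi] agrees with [s], so a moved vertex keeps moving under iteration of
    [phi]; but its iterates reach [W], where [phi] is the identity. *)
Lemma rooted_follows W phi s : phi \in routing W -> rooted W phi ->
  follows s phi -> s = 1%g.
Proof.
move=> phiW /rootedP phiR /forall_inP sphi; apply/permP=> v; rewrite perm1.
apply/eqP/negPn/negP=> sv; have vS : v \in moved s by rewrite inE.
have itS k : iter k phi v \in moved s.
  elim: k => //= k IH; have := sphi _ IH => /eqP <-.
  by move: IH; rewrite !inE (inj_eq perm_inj).
have [k kW] := phiR v; have := itS k; rewrite inE.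
by have /eqP -> := sphi _ (itS k); rewrite (routing_fix phiW kW) eqxx.
Qed.

Lemma ncycles1 : ncycles (1%g : {perm V}) = 0%N.
Proof.
rewrite /ncycles (_ : moved 1 = set0) ?imset0 ?cards0 //.
by apply/setP=> v; rewrite !inE perm1 eqxx.
Qed.

Lemma follows1 phi : follows 1 phi.
Proof. by apply/forall_inP=> v; rewrite inE perm1 eqxx. Qed.

Lemma det_fmatrix_eq0 (m : V -> V -> R) (g : V -> R) v :
  (forall w, \sum_z m w z * g z = 0) -> g v != 0 -> \det (fmatrix m) = 0.
Proof.
(* [det0P] speaks of row vectors in the left kernel, hence the transpose. *)
move=> mg gv; apply/eqP; rewrite -det_tr; apply/det0P.
exists (\col_i g (enum_val i))^T.
  apply/eqP=> /rowP/(_ (enum_rank v)); rewrite !mxE enum_rankK.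
  by move/eqP; rewrite (negbTE gv).
rewrite -trmx_mul fmatrix_mulv; apply/rowP=> i; by rewrite !mxE mg.
Qed.

Lemma step_mul W phi (g : V -> R) v :
  \sum_z step W phi v z * g z = g v - (v \notin W)%:R * g (phi v).
Proof.
under eq_bigr do rewrite mulrBl; rewrite sumrB; congr (_ - _).
  rewrite (bigD1 v) //= eqxx mul1r big1 ?addr0 // => z /negbTE.
  by rewrite eq_sym => ->; rewrite mul0r.
rewrite (bigD1 (phi v)) //= eqxx andbT big1 ?addr0 // => z /negbTE.
by rewrite eq_sym => ->; rewrite andbF mul0r.
Qed.

(* If some vertex never reaches W, then the indicator of the set of such      *)
(* vertices is in the kernel.                                                 *)
Lemma det_step W phi : phi \in routing W ->
  \det (fmatrix (step W phi)) = (rooted W phi)%:R.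
Proof.
move=> phiW; case: (boolP (rooted W phi)) => phiR.
  rewrite (det_step_perm phiW) (big_pred1 (1%g : {perm V})) ?ncycles1 // => s /=.
  by apply/idP/eqP=> [/(rooted_follows phiW phiR)|->] //; apply: follows1.
case/forallPn: phiR => v vW.
pose g w : R := (~~ [exists z in W, fconnect phi w z])%:R.
apply: (@det_fmatrix_eq0 _ g v) => [w|]; last by rewrite /g vW oner_eq0.
rewrite step_mul /g; case: (boolP (w \in W)) => wW.
  rewrite mul0r subr0; suff -> : [exists z in W, fconnect phi w z] by [].
  by apply/exists_inP; exists w; rewrite ?connect0.
rewrite mul1r; apply/eqP; rewrite subr_eq0; apply/eqP.
congr ((~~ _)%:R); apply: eq_existsb => z; case: (boolP (z \in W)) => //= zW.
by rewrite fconnect_eqVf; case: eqP => // wz; rewrite -wz (negbTE wW) in zW.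
Qed.

End Routings.

(** * Cycles given by vertex sequences *)

Section Cycles.
Variable V : finType.
Implicit Types (E D : {set {set V}}) (s : seq V).

Lemma set2_eqP (a b u v : V) :
  [set a; b] = [set u; v] -> (a = u /\ b = v) \/ (a = v /\ b = u).
Proof.
move=> ab; have: a \in [set u; v] by rewrite -ab set21.
have: b \in [set u; v] by rewrite -ab set22.
have: v \in [set a; b] by rewrite ab set22.
have: u \in [set a; b] by rewrite ab set21.
rewrite !inE; do 4![case/orP => /eqP ?]; subst; auto.
Qed.

Lemma cyclesP E D :
  reflect (exists s, [/\ D \subset E, uniq s, (2 < size s)%N & D = cycle_edges s])
          (D \in cycles E).
Proof.
rewrite inE; apply: (iffP andP) => [[DE /existsP[s /and3P[]]]|[s [DE sU s2 DEq]]].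
  by move=> sU s2 /eqP DEq; exists s.
split=> //; apply/existsP.
have sV : (size s <= #|V|)%N by rewrite -(card_uniqP sU) max_card.
by exists (Bseq sV); rewrite sU s2 DEq eqxx.
Qed.

Lemma next_next_neq s v : uniq s -> (2 < size s)%N -> v \in s ->
  next s (next s v) != v.
Proof.
move=> sU s2 vs; have [i t rotE] := rot_to vs.
rewrite -!(next_rot i sU) rotE; move: s2 sU.
rewrite -(size_rot i) -(rot_uniq i) rotE; case: t {rotE} => [|a [|b t]] //= _.
by rewrite !inE !negb_or => /andP[/and3P[va vb _] _];
  rewrite !eqxx [a == v]eq_sym (negbTE va) eq_sym.
Qed.

End Cycles.

(** * Spanning trees as rooted maps, and the matrix-tree theorem *)

Section Trees.
Variable V : finType.
Implicit Types (E T : {set {set V}}) (phi psi : {ffun V -> V}) (W : {set V}).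

Definition edges W phi : {set {set V}} := [set [set v; phi v] | v in ~: W].
Definition no2cycle W phi := [forall (v | v \notin W), phi (phi v) != v].

Lemma edge_inj W phi : no2cycle W phi ->
  {in ~: W &, injective (fun v => [set v; phi v])}.
Proof.
move=> /forall_inP no2 v w; rewrite !inE => vW wW /set2_eqP[[]|[v_phi phi_w]] //.
by have := no2 v vW; rewrite phi_w v_phi eqxx.
Qed.

Lemma weight_edges (R : realFieldType) (c : {set V} -> R) W phi :
  no2cycle W phi -> \prod_(e in edges W phi) c e = weight c W phi.
Proof.
move=> /edge_inj injE; rewrite big_imset //=.
by apply: eq_bigl => v; rewrite inE.
Qed.

Lemma rooted_no2cycle E W phi :
  phi \in routing E W -> rooted W phi -> no2cycle W phi.
Proof.
move=> phiE /rootedP phiR; apply/forall_inP => v vW; apply/eqP=> phi2.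
have phivW : phi v \notin W.
  by apply: contra vW => pW; rewrite -phi2 (routing_fix phiE pW).
have itE k : (iter k phi v == v) || (iter k phi v == phi v).
  elim: k => [|k /= /orP[]/eqP ->]; rewrite ?eqxx ?orbT //.
  by rewrite phi2 eqxx.
by have [k] := phiR v; case/orP: (itE k) => /eqP ->; apply/negP.
Qed.

(** Each vertex is sent to a neighbour strictly closer to [r]. *)
Lemma exists_rooted E r : connected_graph E ->
  exists2 phi, phi \in routing E [set r] & rooted [set r] phi.
Proof.
move=> /forallP Ec.
have pathE v : exists n, [exists p : n.-tuple V, path (adj E) v p && (last v p == r)].
  have /forallP/(_ r)/connectP[p pE rE] := Ec v; exists (size p).
  by apply/existsP; exists (in_tuple p); rewrite /= pE rE eqxx.
pose d v := ex_minn (pathE v).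
have nextP v : v != r -> exists y, adj E v y && (d y < d v)%N.
  move=> vr; rewrite {2}/d; case: ex_minnP => n /existsP[p /andP[]].
  case: p => -[|y p] /= sz; first by rewrite (negbTE vr).
  case/andP=> vy yp yr _; exists y; rewrite vy -(eqP sz) ltnS /d.
  case: ex_minnP => m _; apply; apply/existsP.
  by exists (in_tuple p); rewrite /= yp.
(* The test [v != r] makes the choice fail at the root, so the default value gives [phi r = r]. *)
pose phi := [ffun v => odflt v [pick y | (v != r) && (adj E v y && (d y < d v)%N)]].
have phiP v : v != r -> adj E v (phi v) /\ (d (phi v) < d v)%N.
  move=> vr; rewrite ffunE vr; case: pickP => /= [y /andP[] //|nope].
  by have [y] := nextP v vr; rewrite nope.
exists phi.
  apply/familyP => v; rewrite -topredE /= inE; case: eqP => [->|/eqP/phiP[]//].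
  by rewrite ffunE eqxx; case: pickP => /=.
apply: rootedI => v; have [n] := ubnP (d v); elim: n v => // n IH v dv.
have [->|/phiP[_ dphi]] := eqVneq v r; first by exists 0; rewrite inE /=.
have [k kr] := IH (phi v) (leq_trans dphi dv).
by exists k.+1; rewrite iterSr.
Qed.

Section RootedTree.
Variables (E : {set {set V}}) (r : V) (phi : {ffun V -> V}).
Hypotheses (phiE : phi \in routing E [set r]) (phiR : rooted [set r] phi).

Let depth v := findex phi v r.

Lemma rooted_fconnect v : fconnect phi v r.
Proof. by have /forallP/(_ v)/exists_inP[z] := phiR; rewrite inE => /eqP ->. Qed.

Lemma depth_step v : v != r -> depth v = (depth (phi v)).+1.
Proof. by rewrite eq_sym => vr; apply: fconnect_findex; rewrite ?rooted_fconnect. Qed.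

Lemma edges_rootedP v z : [set v; z] \in edges [set r] phi ->
  v != r /\ z = phi v \/ z != r /\ v = phi z.
Proof.
case/imsetP=> u; rewrite !inE => ur /set2_eqP[[-> ->]|[-> ->]]; first by left.
by right.
Qed.

Lemma edges_rooted_connected : connected_graph (edges [set r] phi).
Proof.
have sym := sym_connect_sym (adj_sym (edges [set r] phi)).
suff to_r v : connect (adj (edges [set r] phi)) v r.
  apply/forallP=> u; apply/forallP=> v; apply: connect_trans (to_r u) _.
  by rewrite sym.
apply: (connect_sub _ (rooted_fconnect v)) => u z /eqP <-.
have [->|ur] := eqVneq u r; first by rewrite (routing_fix phiE) ?set11 ?connect0.
by apply: connect1; apply/imsetP; exists u; rewrite ?inE.
Qed.

(* The two neighbours on a cycle of a vertex of maximal depth would both be   *)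
(* its parent.                                                                *)
Lemma edges_rooted_acyclic : cycles (edges [set r] phi) = set0.
Proof.
apply/setP=> D; rewrite in_set0; apply/negbTE/negP=> /cyclesP[s [DE sU s2 DEq]].
have [w0 w0s] : exists w0, w0 \in s.
  by case: s s2 {sU DEq} => // a s _; exists a; rewrite inE eqxx.
case: (arg_maxnP (P := mem s) depth w0s) => w /= ws wmax.
have parent z : [set w; z] \in D -> z \in s -> z = phi w.
  move=> /(subsetP DE)/edges_rootedP[[]|[zr wE]] // /wmax.
  by rewrite (depth_step zr) -wE /= ltnn.
have nextw : next s w = phi w.
  by apply: parent; rewrite ?mem_next // DEq; apply/imsetP; exists w.
have prevw : prev s w = phi w.
  apply: parent; rewrite ?mem_prev // DEq; apply/imsetP; exists (prev s w).
    by rewrite mem_prev.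
  by rewrite next_prev // setUC.
have := next_next_neq sU s2 ws.
by rewrite nextw -prevw next_prev // eqxx.
Qed.

Lemma edges_rooted_sub : edges [set r] phi \subset E.
Proof.
apply/subsetP=> e /imsetP[v]; rewrite inE => vr ->.
exact: (routing_adj phiE vr).
Qed.

Lemma edges_rooted_spanning : edges [set r] phi \in spanning_trees E.
Proof.
by rewrite inE edges_rooted_sub edges_rooted_connected edges_rooted_acyclic eqxx.
Qed.

(** Induction on the depth. If [{v, phi v}] came from [psi] at [phi v] rather than at [v], then
    [psi (phi v) = v]; as the maps agree at the shallower vertex [phi v], [phi] would have a
    2-cycle. *)
Lemma edges_rooted_eq psi : psi \in routing E [set r] ->
  edges [set r] phi = edges [set r] psi -> phi = psi.
Proof.
move=> psiE edgesE; apply/ffunP=> v.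
have [n] := ubnP (depth v); elim: n v => // n IH v dv.
have [->|vr] := eqVneq v r.
  by rewrite (routing_fix phiE) ?(routing_fix psiE) ?set11.
have : [set v; phi v] \in edges [set r] psi.
  by rewrite -edgesE; apply: imset_f; rewrite !inE.
case/imsetP=> u; rewrite !inE => ur /set2_eqP[[-> ->] //|[vE phi_v]].
have := rooted_no2cycle phiE phiR => /forall_inP/(_ v).
rewrite inE vr phi_v => /(_ isT); rewrite IH; first by rewrite vE eqxx.
by rewrite -ltnS (leq_trans _ dv) // ltnS -phi_v (depth_step vr).
Qed.

End RootedTree.

(** A rooted map inside [T] already has connected edges, so another edge of [T] would close a path
    of them into a cycle of [T]. *)
Lemma spanning_treeP E T r : simple_graph E -> T \in spanning_trees E ->
  exists phi, [/\ phi \in routing E [set r], rooted [set r] phi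
                & T = edges [set r] phi].
Proof.
move=> E_simple; rewrite inE => /and3P[TE Tc Tacyclic].
have [phi phiT phiR] := exists_rooted r Tc.
have phiE : phi \in routing E [set r].
  apply/familyP => v; have /familyP/(_ v) := phiT; rewrite -!topredE /=.
  by case: ifP => // _; apply: (subsetP TE).
have phi_sub := edges_rooted_sub phiT.
exists phi; split=> //; apply/eqP; rewrite eqEsubset phi_sub andbT.
apply/subsetP=> e eT; apply: contraT => e_phi.
have /eqP/cards2P[a [b [ab eE]]] := E_simple _ (subsetP TE e eT).
have /forallP/(_ a)/forallP/(_ b)/connectP[p0 p0E bE] := edges_rooted_connected phiT phiR.
case/shortenP: p0E bE => p pE pU _ bE.
have s2 : (2 < size (a :: p))%N.
  case: p pE bE {pU} => [|y [|]] //= pE bE; first by rewrite bE eqxx in ab.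
  by move: pE; rewrite andbT -bE /adj /= -eE (negbTE e_phi).
have cyc : path.cycle (adj T) (a :: p).
  rewrite /= rcons_path -bE [adj T b a]adj_sym /adj /= -eE eT andbT.
  by apply: sub_path pE => u v /=; apply: (subsetP phi_sub).
suff : cycle_edges (a :: p) \in cycles T by rewrite (eqP Tacyclic) inE.
apply/cyclesP; exists (a :: p); split=> //.
by apply/subsetP=> _ /imsetP[v vp ->]; apply: (next_cycle cyc vp).
Qed.

(** By [det_step] only rooted maps survive in [det_laplacian], and orienting trees towards [r] puts
    these in bijection with the spanning trees. *)
Lemma tree_weightE (R : realFieldType) (c : {set V} -> R) E r : simple_graph E ->
  tree_weight E c = \det (fmatrix (laplacian E c [set r])).
Proof.
move=> Es; rewrite det_laplacian.
transitivity (\sum_(phi in [set phi | (phi \in routing E [set r]) && rooted [set r] phi])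
                weight c [set r] phi); last first.
  rewrite [RHS](bigID (rooted [set r])) /= [X in _ = _ + X]big1 ?addr0; last first.
    by move=> phi /andP[phiE /negbTE nR]; rewrite (det_step _ Es) // nR mulr0.
  by apply: eq_big => phi; rewrite ?inE // => /andP[phiE phiR];
    rewrite (det_step _ Es) // phiR mulr1.
have -> : tree_weight E c = \sum_(T in edges [set r] @:
    [set phi | (phi \in routing E [set r]) && rooted [set r] phi]) \prod_(e in T) c e.
  apply: eq_bigl => T; apply/idP/imsetP=> [/(spanning_treeP r Es)[phi [pE pR ->]]|].
    by exists phi => //; rewrite inE; apply/andP.
  by case=> phi; rewrite inE => /andP[pE pR] ->; exact: (edges_rooted_spanning pE pR).
rewrite big_imset /= => [|phi psi]; last first.
  by rewrite !in_set => /andP[pE pR] /andP[qE _]; apply: (edges_rooted_eq pE pR qE).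
apply: eq_bigr => phi; rewrite inE => /andP[phiE phiR].
by rewrite weight_edges // (rooted_no2cycle phiE).
Qed.

Lemma tree_weight_gt0 (R : realFieldType) (c : {set V} -> R) E (r : V) :
    simple_graph E -> connected_graph E -> (forall e, e \in E -> 0 < c e) ->
  0 < tree_weight E c.
Proof.
move=> Es Ec c0; have [phi phiE phiR] := exists_rooted r Ec.
have prod0 T : T \in spanning_trees E -> 0 < \prod_(e in T) c e.
  rewrite inE => /and3P[/subsetP TE _ _].
  by apply: prodr_gt0 => e /TE/c0.
have phiT := edges_rooted_spanning phiE phiR.
rewrite /tree_weight (bigD1 _ phiT) /= ltr_wpDr ?prod0 //.
by apply: sumr_ge0 => T /andP[/prod0/ltW].
Qed.

End Trees.

(** * Effective resistance as a quotient of determinants *)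

Section Resistance.
Variables (R : realFieldType) (V : finType) (E : {set {set V}}).
Variable c : {set V} -> R.
Hypotheses (E_simple : simple_graph E) (E_connected : connected_graph E).
Hypothesis c_gt0 : forall e, e \in E -> 0 < c e.
Implicit Types (W : {set V}) (f g : V -> R).

Lemma laplacian_mul W g w : w \notin W ->
  \sum_z laplacian E c W w z * g z
    = \sum_(y | adj E w y) c [set w; y] * (g w - g y).
Proof.
move=> /negbTE wW; rewrite /laplacian wW; under eq_bigr do rewrite mulr_suml.
rewrite exchange_big; apply: eq_bigr => y _ /=.
under eq_bigr do rewrite -mulrA mulrBl mulrBr; rewrite sumrB mulrBr.
congr (_ - _); rewrite -mulr_sumr; congr (_ * _).
  rewrite (bigD1 w) //= eqxx mul1r big1 ?addr0 // => z /negbTE.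
  by rewrite eq_sym => ->; rewrite mul0r.
rewrite (bigD1 y) //= eqxx mul1r big1 ?addr0 // => z /negbTE.
by rewrite eq_sym => ->; rewrite mul0r.
Qed.

Lemma laplacian_mul_in W g w : w \in W -> \sum_z laplacian E c W w z * g z = g w.
Proof.
move=> wW; rewrite /laplacian wW (bigD1 w) //= eqxx mul1r big1 ?addr0 // => z.
by rewrite eq_sym => /negbTE ->; rewrite mul0r.
Qed.

(** The current along an edge is antisymmetric in its endpoints, so the sum equals its own
    opposite. *)
Lemma sum_current0 g :
  \sum_w \sum_(y | adj E w y) c [set w; y] * (g w - g y) = 0.
Proof.
set S := LHS; suff SN : S = - S.
  by apply/eqP; have /eqP := SN; rewrite -addr_eq0 -mulr2n mulrn_eq0.
rewrite {1}/S (exchange_big_dep xpredT) //= -sumrN; apply: eq_bigr => w _.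
rewrite -sumrN; apply: eq_big => [y|y _]; first by rewrite adj_sym.
by rewrite setUC -mulrN opprB.
Qed.

(** The two matrices differ only in row [u], which in the second is a unit vector; expand along
    it. *)
Lemma cofactor_laplacian (u v : V) : u != v ->
  cofactor (fmatrix (laplacian E c [set v])) (enum_rank u) (enum_rank u)
    = \det (fmatrix (laplacian E c [set u; v])).
Proof.
move=> uv; rewrite (expand_det_row _ (enum_rank u)).
rewrite (bigD1 (enum_rank u)) //= big1 ?addr0 => [|i iu]; last first.
  rewrite mxE /laplacian enum_rankK set21.
  case: eqP => [uE|]; last by rewrite mul0r.
  by rewrite -(enum_valK i) -uE eqxx in iu.
rewrite mxE enum_rankK {2}/laplacian set21 eqxx mul1r /cofactor; congr (_ * \det _).
apply/matrixP=> i j; rewrite !mxE /laplacian !inE.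
case: (enum_val (lift _ i) =P u) => [iu|//].
by have := neq_lift (enum_rank u) i; rewrite -{1}iu enum_valK eqxx.
Qed.

Lemma unit_current_potential_resistance (u v : V) f : u != v ->
  unit_current_potential E c u v f ->
  (f u - f v) * tree_weight E c = \det (fmatrix (laplacian E c [set u; v])).
Proof.
move=> uv fP; rewrite -(cofactor_laplacian uv) (tree_weightE c v E_simple).
(* Grounding the potential at [v] satisfies the replaced row [g v = 0]. *)
set M := fmatrix _; pose g w := f w - f v.
have Mg : M *m (\col_i g (enum_val i)) = delta_mx (enum_rank u) 0.
  rewrite fmatrix_mulv; apply/matrixP=> i j; rewrite !mxE ord1 eqxx andbT.
  rewrite -{2}(enum_valK i) (inj_eq enum_rank_inj).
  have [iv|iv] := eqVneq (enum_val i) v.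
    by rewrite laplacian_mul_in iv ?set11 // /g subrr eq_sym (negbTE uv).
  rewrite laplacian_mul ?inE //.
  under eq_bigr do rewrite /g opprB addrA subrK.
  by rewrite fP (negbTE iv) subr0.
(* Cramer's rule: multiply by the adjugate and read off the entry at [u]. *)
have /matrixP/(_ (enum_rank u) 0) := congr1 (mulmx (\adj M)) Mg.
rewrite mulmxA mul_adj_mx mul_scalar_mx -colE !mxE enum_rankK => <-.
by rewrite mulrC.
Qed.

Lemma exists_unit_current_potential (u v : V) : u != v ->
  exists f, unit_current_potential E c u v f.
Proof.
move=> uv; pose M := fmatrix (laplacian E c [set v]).
have Mu : M \in unitmx.
  by rewrite unitmxE unitfE -(tree_weightE c v) // lt0r_neq0 // (tree_weight_gt0 v).
pose f w := (invmx M *m delta_mx (enum_rank u) (0 : 'I_1)) (enum_rank w) 0.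
have fE w : \sum_z laplacian E c [set v] w z * f z = (w == u)%:R.
  have := mulKVmx Mu (delta_mx (enum_rank u) (0 : 'I_1)).
  have -> : invmx M *m delta_mx (enum_rank u) (0 : 'I_1) = \col_i f (enum_val i).
    by apply/matrixP=> i j; rewrite [RHS]mxE ord1 /f enum_valK.
  rewrite fmatrix_mulv => /matrixP/(_ (enum_rank w) 0); rewrite !mxE.
  by rewrite enum_rankK eqxx andbT (inj_eq enum_rank_inj).
have fP w : w != v ->
    \sum_(y | adj E w y) c [set w; y] * (f w - f y) = (w == u)%:R.
  by move=> wv; rewrite -fE laplacian_mul ?inE.
(* Kirchhoff's law at [v], absent from the system solved, follows from the total current being
   zero. *)
exists f => w; have [->|wv] := eqVneq w v; last by rewrite fP // subr0.
have := sum_current0 f; rewrite (bigD1 v) //= => /eqP; rewrite addr_eq0 => /eqP ->.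
rewrite (eq_bigr (fun w => (w == u)%:R)) //.
rewrite (bigD1 u) //= eqxx big1 ?addr0 => [|z /andP[_ /negbTE ->]] //.
by rewrite [v == u]eq_sym (negbTE uv) sub0r.
Qed.

Lemma effective_resistanceE (u v : V) : u != v ->
  effective_resistance E c u v
    = (tree_weight E c)^-1 * \det (fmatrix (laplacian E c [set u; v])).
Proof.
move=> uv; have t0 : tree_weight E c != 0 by rewrite lt0r_neq0 // (tree_weight_gt0 u).
rewrite /effective_resistance; set S := (fun r => _).
have [f fP] := exists_unit_current_potential uv.
have : exists r, S r by exists (f u - f v); exists f.
case/(classical_sets.xgetPex 0) => g gP ->.
by rewrite -(unit_current_potential_resistance uv gP) mulrC mulfK.
Qed.

End Resistance.

(** * Permutations without 2-cycles as oriented unions of cycles *)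

Section Orientations.
Variable V : finType.
Implicit Types (E C D : {set {set V}}) (s : {perm V}) (Q : {set {set V}}).

Definition no2perm s := [forall v in moved s, s (s v) != v].
Definition perm_edges s : {set {set V}} := [set [set v; s v] | v in moved s].

Lemma perm_moved s v : (s v \in moved s) = (v \in moved s).
Proof. by rewrite !inE (inj_eq perm_inj). Qed.

Lemma permV_moved s v : ((s^-1)%g v \in moved s) = (v \in moved s).
Proof. by rewrite -perm_moved permKV. Qed.

Lemma mem_perm_edges s w z :
  ([set w; z] \in perm_edges s) = (w != z) && ((z == s w) || (w == s z)).
Proof.
apply/imsetP/andP=> [[v]|[wz]].
  rewrite inE => vS /set2_eqP[[-> ->]|[-> ->]]; rewrite ?eqxx ?orbT //.
  by rewrite eq_sym.
case/orP=> /eqP zE; [exists w|exists z]; rewrite ?inE -?zE //.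
  by rewrite eq_sym.
by rewrite setUC.
Qed.

Lemma cover_perm_edges s : cover (perm_edges s) = moved s.
Proof.
apply/setP=> v; apply/bigcupP/idP=> [[e /imsetP[w wS ->]]|vS].
  by rewrite !inE => /orP[]/eqP ->; rewrite ?(inj_eq perm_inj) //; rewrite inE in wS.
by exists [set v; s v]; [apply: imset_f | apply: set21].
Qed.

Lemma prod_perm_edges (R : comPzRingType) (c : {set V} -> R) s : no2perm s ->
  \prod_(e in perm_edges s) c e = \prod_(v in moved s) c [set v; s v].
Proof.
move=> /forall_inP no2; rewrite big_imset //= => v w vS wS.
case/set2_eqP=> [[] //|[vE wE]]; by have := no2 v vS; rewrite wE -vE eqxx.
Qed.

Lemma connect_perm_edges s w z :
  connect (adj (perm_edges s)) w z = (z \in porbit s w).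
Proof.
apply/idP/idP=> [/connectP[p]|/porbitP[i ->]].
  elim: p w => [|y p IH] w /= => [_ ->|/andP[wy yp] zE]; first exact: porbit_id.
  have := IH y yp zE; suff -> : porbit s w = porbit s y by [].
  move: wy; rewrite /adj /= mem_perm_edges => /andP[_].
  by case/orP=> /eqP ->; rewrite -[s _]/((s ^+ 1)%g _) porbit_perm.
elim: i => [|i IH]; first by rewrite expg0 perm1 connect0.
apply: connect_trans IH _; rewrite expgSr permM; set y := (s ^+ i)%g w.
have [-> //|sy] := eqVneq (s y) y.
by apply: connect1; rewrite /adj /= mem_perm_edges eq_sym sy eqxx.
Qed.

Lemma num_components_perm_edges s : num_components (perm_edges s) = ncycles s.
Proof.
have sym := sym_connect_sym (adj_sym (perm_edges s)).
rewrite /num_components /n_comp_mem cover_perm_edges /ncycles.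
(* One representative per component: [porbit s] is injective on [A] and has the same image as on all
   of [moved s]. *)
set A := [set v in moved s | v \in roots (adj (perm_edges s))].
rewrite (_ : _ @: _ = porbit s @: A); last first.
  apply/setP=> B; apply/imsetP/imsetP=> -[v vS ->]; last first.
    by exists v => //; move: vS; rewrite inE => /andP[].
  have := connect_root (adj (perm_edges s)) v.
  rewrite connect_perm_edges => rv; exists (fingraph.root (adj (perm_edges s)) v).
    by rewrite in_set (moved_porbit rv) vS; apply: (roots_root sym).
  by apply/eqP; rewrite eq_porbit_mem porbit_sym.
rewrite card_in_imset => [|v w]; first by apply: eq_card => v; rewrite !inE andbC.
rewrite !inE => /andP[_ /eqP vr] /andP[_ /eqP wr] vw.
by rewrite -vr -wr; apply/(fingraph.rootP sym); rewrite connect_perm_edges vw porbit_id.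
Qed.

Lemma perm_edges1 : perm_edges 1 = set0.
Proof.
by apply/setP=> e; rewrite in_set0; apply/imsetP=> -[v]; rewrite inE perm1 eqxx.
Qed.

Lemma no2perm1 : no2perm 1.
Proof. by apply/forall_inP=> v; rewrite inE perm1 eqxx. Qed.

Lemma perm_edges_cycle_union E s : no2perm s -> perm_edges s \subset E ->
  perm_edges s != set0 -> perm_edges s \in cycle_unions E.
Proof.
move=> /forall_inP no2 sE s0.
pose D v : {set {set V}} := [set [set z; s z] | z in fingraph.orbit s v].
have memO v z : (z \in fingraph.orbit s v) = fconnect s v z by rewrite fconnect_orbit.
have sym := fconnect_sym (@perm_inj _ s).
have movedO v z : fconnect s v z -> (z \in moved s) = (v \in moved s).
  move/iter_findex <-; elim: (findex _ _ _) => //= k IH.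
  by rewrite perm_moved.
have coverD v : cover (D v) = [set z | fconnect s v z].
  apply/setP=> z; rewrite inE; apply/bigcupP/idP=> [[e /imsetP[y]]|vz].
    rewrite memO => vy ->; rewrite !inE => /orP[]/eqP -> //.
    exact: connect_trans vy (fconnect1 _ _).
  by exists [set z; s z]; [apply: imset_f; rewrite memO | apply: set21].
have Ds v : v \in moved s -> D v \subset perm_edges s.
  move=> vS; apply/subsetP=> e /imsetP[z]; rewrite memO => vz ->.
  by apply: imset_f; rewrite (movedO v).
rewrite inE; apply/existsP; exists (D @: moved s); apply/and4P; split.
- case/set0Pn: s0 => e /imsetP[v vS _].
  by apply/set0Pn; exists (D v); apply: imset_f.
- apply/subsetP=> _ /imsetP[v vS ->]; apply/cyclesP.
  exists (fingraph.orbit s v); split.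
  + exact: subset_trans (Ds v vS) sE.
  + exact: orbit_uniq.
  (* Without 2-cycles [v], [s v] and [s (s v)] are distinct, so the orbit is a genuine graph
     cycle. *)
  + apply: (@leq_trans (size [:: v; s v; s (s v)])) => //; apply: uniq_leq_size.
      have := no2 v vS; move: (vS); rewrite inE /= !inE andbT.
      by rewrite ![v == _]eq_sym negb_or !(inj_eq perm_inj) eq_sym => -> ->.
    by move=> z; rewrite !inE memO => /or3P[]/eqP ->;
       rewrite ?connect0 ?fconnect1 // (fconnect_iter s 2).
  + apply: eq_in_imset => z zO; congr [set _; _].
    by rewrite (nextE (cycle_orbit (@perm_inj _ s) v)).
- apply/forall_inP=> _ /imsetP[v vS ->]; apply/forall_inP=> _ /imsetP[w wS ->].
  apply/implyP; apply: contraR; rewrite !coverD => /pred0Pn[u /=].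
  rewrite !inE => /andP[vu]; rewrite sym => uw; apply/eqP.
  have vw := same_connect sym (connect_trans vu uw).
  by apply/setP=> e; apply/imsetP/imsetP=> -[z zO ->]; exists z => //;
     move: zO; rewrite !memO vw.
- rewrite eq_sym eqEsubset; apply/andP; split.
    by apply/bigcupsP=> _ /imsetP[v vS ->]; apply: Ds.
  apply/subsetP=> _ /imsetP[v vS ->]; apply/bigcupP; exists (D v).
    exact: imset_f.
  by apply: imset_f; rewrite memO connect0.
Qed.

Lemma cover_cycle_edges (t : seq V) : cover (cycle_edges t) = [set v in t].
Proof.
apply/setP=> v; rewrite inE; apply/bigcupP/idP=> [[e /imsetP[w wt ->]]|vt].
  by rewrite !inE => /orP[]/eqP ->; rewrite ?mem_next.
by exists [set v; next t v]; [apply: imset_f | apply: set21].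
Qed.

Lemma cycle_union_perm E C : C \in cycle_unions E ->
  exists s, [/\ no2perm s, perm_edges s = C & C \subset E].
Proof.
rewrite inE => /existsP[P /and4P[_ /subsetP PE /forall_inP Pdisj /eqP ->]].
(* A cyclic sequence for each cycle of [P] is a choice of orientation; the permutation sought is the
   successor along these sequences. *)
have [S SP] : exists S : {set {set V}} -> seq V, forall D, D \in P ->
    [/\ uniq (S D), (2 < size (S D))%N & D = cycle_edges (S D)].
  apply: (fin_all_exists (P := fun D t => D \in P ->
    [/\ uniq t, (2 < size t)%N & D = cycle_edges t])) => D.
  case: (boolP (D \in P)) => [/PE/cyclesP[t [_ ? ? ?]]|_]; last by exists [::].
  by exists t.
have memS D v : D \in P -> (v \in S D) = (v \in cover D).
  by move=> /SP[_ _ {2}->]; rewrite cover_cycle_edges inE.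
have S_uniq D D' v : D \in P -> D' \in P -> v \in S D -> v \in S D' -> D = D'.
  move=> DP DP'; rewrite !memS // => vD vD'; apply/eqP; apply: contraT => DD'.
  have /forall_inP/(_ D' DP')/implyP/(_ DD') := Pdisj D DP.
  by move/pred0P/(_ v); rewrite /= vD vD'.
pose f v := if [pick D in P | v \in S D] is Some D then next (S D) v else v.
have fE D v : D \in P -> v \in S D -> f v = next (S D) v.
  move=> DP vD; rewrite /f; case: pickP => [D' /andP[D'P vD']|/(_ D)].
    by rewrite (S_uniq D D' v).
  by rewrite DP vD.
have f_out v : (forall D, D \in P -> v \notin S D) -> f v = v.
  by move=> vS; rewrite /f; case: pickP => // D /andP[/vS/negbTE ->].
have f_case v : (exists2 D, D \in P & v \in S D) \/ forall D, D \in P -> v \notin S D.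
  case: (boolP [exists D in P, v \in S D]) => [/exists_inP[D]|/exists_inPn];
    last by right.
  by left; exists D.
have f_inj : injective f.
  move=> v w; case: (f_case v) (f_case w) => [[D DP vD]|vS] [[D' DP' wD]|wS].
  - rewrite (fE D v) // (fE D' w) // => vw.
    have DD' : D = D' by apply: (S_uniq _ _ (next (S D) v));
      rewrite ?mem_next // vw mem_next.
    have [DU _ _] := SP D DP.
    by rewrite -(prev_next DU v) vw -DD' prev_next.
  - rewrite (fE D v) // (f_out w) // => vw.
    by have := wS D DP; rewrite -vw mem_next vD.
  - rewrite (fE D' w) // (f_out v) // => vw.
    by have := vS D' DP'; rewrite vw mem_next wD.
  - by rewrite !f_out.
pose s := perm f_inj.
have sE D v : D \in P -> v \in S D -> s v = next (S D) v by rewrite permE; apply: fE.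
have movedS D v : D \in P -> v \in S D -> v \in moved s.
  move=> DP vD; have [DU D2 _] := SP D DP; rewrite inE (sE D) //.
  by apply: contra (next_next_neq DU D2 vD) => /eqP nv; rewrite !nv.
have movedE v : v \in moved s -> exists2 D, D \in P & v \in S D.
  by rewrite inE permE; case: (f_case v) => // /f_out ->; rewrite eqxx.
exists s; split.
- apply/forall_inP=> v /movedE[D DP vD]; have [DU D2 _] := SP D DP.
  by rewrite (sE D v) // (sE D) ?mem_next // next_next_neq.
- apply/setP=> e; apply/imsetP/bigcupP=> [[v /movedE[D DP vD] ->]|[D DP]].
    exists D => //; have [_ _ DE] := SP D DP.
    by rewrite DE (sE D) //; apply: imset_f.
  have [_ _ {1}->] := SP D DP; case/imsetP=> v vD ->.
  by exists v; rewrite ?(movedS D) // (sE D).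
- by apply/bigcupsP=> D /PE/cyclesP[t []].
Qed.

Section Reorient.
Variable s0 : {perm V}.
Hypothesis s0_no2 : no2perm s0.

Lemma s0V_neq v : v \in moved s0 -> s0 v != (s0^-1)%g v.
Proof.
move=> vS; have /forall_inP/(_ v vS) := s0_no2; apply: contra => /eqP ->.
by rewrite permKV.
Qed.

(** [Q] is the set of cycles that keep their direction; the others are reversed. *)
Definition reorient_fun Q v :=
  if porbit s0 v \in Q then s0 v else (s0^-1)%g v.

Lemma porbit_reorient Q v : porbit s0 (reorient_fun Q v) = porbit s0 v.
Proof.
rewrite /reorient_fun; case: ifP => _; first by rewrite -[s0 v]/((s0 ^+ 1)%g v) porbit_perm.
by apply/esym; rewrite -{1}[v](permKV s0) -[s0 _]/((s0 ^+ 1)%g _) porbit_perm.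
Qed.

Lemma reorient_inj Q : injective (reorient_fun Q).
Proof.
move=> v w vw; have := porbit_reorient Q v; rewrite vw porbit_reorient => po.
by move: vw; rewrite /reorient_fun po; case: ifP => _; apply: perm_inj.
Qed.

Definition reorient Q := perm (@reorient_inj Q).

Lemma reorientE Q v : reorient Q v = if porbit s0 v \in Q then s0 v else (s0^-1)%g v.
Proof. by rewrite permE. Qed.

Lemma moved_reorient Q : moved (reorient Q) = moved s0.
Proof.
apply/setP=> v; rewrite !inE reorientE; case: ifP => _ //.
by rewrite -(inj_eq (@perm_inj _ s0)) permKV eq_sym.
Qed.

Lemma no2perm_reorient Q : no2perm (reorient Q).
Proof.
apply/forall_inP=> v; rewrite moved_reorient => vS.
have po := porbit_reorient Q v; rewrite /reorient_fun in po.
rewrite !reorientE po; case: (porbit s0 v \in Q);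
  first by have /forall_inP/(_ v vS) := s0_no2.
rewrite -(inj_eq (@perm_inj _ s0)) permKV eq_sym.
exact: s0V_neq.
Qed.

Lemma perm_edges_reorient Q : perm_edges (reorient Q) = perm_edges s0.
Proof.
apply/setP=> e; apply/imsetP/imsetP=> -[v]; rewrite ?moved_reorient => vS ->.
  rewrite reorientE; case: ifP => _; first by exists v.
  by exists ((s0^-1)%g v); rewrite ?permV_moved // permKV setUC.
have po : porbit s0 (s0 v) = porbit s0 v by rewrite -[s0 v]/((s0 ^+ 1)%g v) porbit_perm.
case: (boolP (porbit s0 v \in Q)) => vQ.
  by exists v; rewrite ?moved_reorient // reorientE vQ.
exists (s0 v); rewrite ?moved_reorient ?perm_moved //.
by rewrite reorientE po (negbTE vQ) permK setUC.
Qed.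

Lemma reorient_powerset_inj :
  {in powerset (porbit s0 @: moved s0) &, injective reorient}.
Proof.
suff sub Q Q' : Q \subset porbit s0 @: moved s0 -> reorient Q = reorient Q' ->
  Q \subset Q'.
  move=> Q Q'; rewrite !powersetE => QS QS' QQ'.
  apply/eqP; rewrite eqEsubset; apply/andP; split; exact: sub.
move=> /subsetP QS /permP QQ'; apply/subsetP=> B BQ.
have /imsetP[v vS BE] := QS B BQ; move: BQ; rewrite BE => vQ.
have := QQ' v; rewrite !reorientE vQ; case: ifP => // _ /eqP.
by rewrite (negbTE (s0V_neq vS)).
Qed.

(* Two orientations of the same edges which agree at v agree at its successor *)
(* as well, because the successor has only two neighbours.                    *)
Lemma reorientP s : no2perm s -> perm_edges s = perm_edges s0 ->
  exists2 Q, Q \in powerset (porbit s0 @: moved s0) & s = reorient Q.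
Proof.
move=> s_no2 sE.
have movedE : moved s = moved s0 by rewrite -!cover_perm_edges sE.
have nbr v : v \in moved s0 -> s v = s0 v \/ s v = (s0^-1)%g v.
  move=> vS; have : [set v; s v] \in perm_edges s by apply: imset_f; rewrite movedE.
  rewrite sE mem_perm_edges => /andP[_ /orP[]/eqP vE]; [by left|right].
  by rewrite [in RHS]vE permK.
have agree v : v \in moved s0 -> s v = s0 v -> s (s0 v) = s0 (s0 v).
  move=> vS vE; have svS : s0 v \in moved s0 by rewrite perm_moved.
  case: (nbr _ svS) => [//|].
  rewrite permK -vE => vE'; have /forall_inP/(_ v) := s_no2.
  by rewrite movedE vS vE' eqxx => /(_ isT).
have agree_orbit v z : v \in moved s0 -> s v = s0 v -> z \in porbit s0 v -> s z = s0 z.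
  move=> vS vE /porbitP[i ->]; elim: i => [|i IH]; first by rewrite expg0 perm1.
  rewrite expgSr permM; apply: agree IH.
  by rewrite (@moved_porbit _ s0 v) ?mem_porbit.
exists (porbit s0 @: [set v in moved s0 | s v == s0 v]).
  by rewrite powersetE; apply/imsetS/subsetP=> v; rewrite inE => /andP[].
apply/permP=> v; rewrite reorientE.
case: (boolP (v \in moved s0)) => [vS|vS]; last first.
  have := vS; rewrite -movedE inE negbK => /eqP ->; move: vS;
    rewrite inE negbK => /eqP vE.
  by case: ifP; rewrite ?vE // -{3}vE permK.
case: ifP => [/imsetP[w]|vQ].
  rewrite inE => /andP[wS /eqP wE] vw; apply: (agree_orbit w) => //.
  by rewrite -vw porbit_id.
case: (nbr v vS) => // vE; move/negbT/negP: vQ; case.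
by apply: imset_f; rewrite inE vS vE eqxx.
Qed.

Lemma card_orientations :
  #|[set s | no2perm s && (perm_edges s == perm_edges s0)]| = (2 ^ ncycles s0)%N.
Proof.
rewrite /ncycles -card_powerset -(card_in_imset reorient_powerset_inj).
apply: eq_card => s; rewrite inE; apply/andP/imsetP=> [[sn /eqP sE]|[Q _ ->]].
  exact: reorientP.
by rewrite no2perm_reorient perm_edges_reorient.
Qed.

End Reorient.

(** Permutations are grouped by their edge set [C]: there are [2^p] of them ([card_orientations]),
    each of sign [(-1)^p]. The identity accounts for [g set0]. *)
Lemma sum_cycle_unions (R : comNzRingType) E (g : {set {set V}} -> R) :
  g set0 + \sum_(C in cycle_unions E) (- 2) ^+ num_components C * g C =
  \sum_(s | no2perm s && (perm_edges s \subset E)) (-1) ^+ ncycles s * g (perm_edges s).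
Proof.
have nonempty : set0 \notin cycle_unions E.
  apply/negP; rewrite inE => /existsP[P /and4P[/set0Pn[D DP] /subsetP PE _ /eqP P0]].
  have /cyclesP[[|v t] [_ _ t2 DE]] // := PE D DP.
  have : [set v; next (v :: t) v] \in D by rewrite DE; apply: imset_f; rewrite inE eqxx.
  move=> eD; have : D \subset cover P by apply: bigcup_sup DP.
  by rewrite -P0 => /subsetP/(_ _ eD); rewrite inE.
have comp0 : num_components (set0 : {set {set V}}) = 0%N.
  by rewrite -perm_edges1 num_components_perm_edges ncycles1.
transitivity (\sum_(C in set0 |: cycle_unions E) (- 2) ^+ num_components C * g C).
  by rewrite big_setU1 //= comp0 mul1r.
rewrite [RHS](partition_big (@perm_edges) (mem (set0 |: cycle_unions E))) /=;
  last first.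
  move=> s /andP[sn sE]; rewrite !inE; case: eqP => //= /eqP s0.
  by have := perm_edges_cycle_union sn sE s0; rewrite inE.
apply: eq_bigr => C CE.
have [s0 [s0n s0C CsubE]] : exists s, [/\ no2perm s, perm_edges s = C & C \subset E].
  case/setU1P: CE => [->|/cycle_union_perm //].
  by exists 1%g; rewrite no2perm1 perm_edges1 sub0set.
rewrite (eq_bigr (fun=> (-1) ^+ num_components C * g C)); last first.
  by move=> s /andP[_ /eqP <-]; rewrite num_components_perm_edges.
rewrite (eq_bigl (fun s => s \in [set s | no2perm s && (perm_edges s == perm_edges s0)])).
  rewrite sumr_const card_orientations // -s0C num_components_perm_edges.
  by rewrite -mulrnAl -[_ *+ (2 ^ _)]mulr_natl natrX -exprMn mulrN1.
move=> s; rewrite inE s0C; case: (perm_edges s =P C) => [->|]; rewrite ?andbF //.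
by rewrite CsubE !andbT.
Qed.

End Orientations.

(** * Exchange of sums: cycles split off from maps without 2-cycles *)

Section Injections.
Variables (R : realFieldType) (V : finType) (E : {set {set V}}).
Variables (c : {set V} -> R) (x : V -> R).
Hypotheses (E_simple : simple_graph E) (x_gt0 : forall v, 0 < x v).
Implicit Types (W X Y : {set V}) (phi : {ffun V -> V}) (s : {perm V}).

Definition no2weight X : R :=
  \sum_(phi in routing E X | no2cycle X phi) weight c X phi.

Lemma det_laplacian_perm W :
  \det (fmatrix (laplacian E c W)) =
  \sum_(s | [&& no2perm s, perm_edges s \subset E & [disjoint moved s & W]])
    (-1) ^+ ncycles s * (\prod_(v in moved s) c [set v; s v])
    * no2weight (W :|: moved s).
Proof.
(* A map with a 2-cycle off [W] is not rooted and has coefficient [0]. Dropping it before expanding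
   ensures that no [s] in the sum has a 2-cycle. *)
rewrite det_laplacian (bigID (no2cycle W)) /= [X in _ + X]big1 ?addr0; last first.
  move=> phi /andP[phiW n2]; rewrite (det_step _ E_simple) //.
  case: (boolP (rooted W phi)) => [/(rooted_no2cycle phiW)|_]; last by rewrite mulr0.
  by rewrite (negbTE n2).
under eq_bigr => phi /andP[phiW _] do rewrite (det_step_perm _ E_simple) // mulr_sumr.
rewrite (exchange_big_dep
  (fun s => [&& no2perm s, perm_edges s \subset E & [disjoint moved s & W]])) /=.
  apply: eq_bigr => s /and3P[/forall_inP s_no2 /subsetP sE sW].
  have notinW v : v \in moved s -> v \notin W by move=> vS; rewrite (disjointFr sW vS).
  have sadj v : v \in moved s -> adj E v (s v) by move=> vS; apply: sE; apply: imset_f.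
  (* [h] writes [s] onto the moved vertices and [h'] turns them into fixed points: this matches the
     maps following [s] with the routings fixing [W :|: moved s]. *)
  pose h phi := [ffun v => if v \in moved s then s v else phi v].
  pose h' phi := [ffun v => if v \in moved s then v else phi v].
  rewrite (reindex_onto h h') => [|phi /andP[_ /forall_inP sphi]]; last first.
    apply/ffunP=> v; rewrite !ffunE; case: (boolP (v \in moved s)) => [vS|//].
    exact/eqP/sphi.
  rewrite /no2weight mulr_sumr; apply: eq_big => [phi|phi /andP[_ /eqP phiE]].
    apply/idP/idP.
      case/andP=> /andP[/andP[hW /forall_inP n2] _] /eqP phiE.
      have phiS v : v \in moved s -> phi v = v by rewrite -phiE ffunE => ->.
      have hN v : v \notin moved s -> h phi v = phi v by rewrite ffunE => /negbTE ->.
      have phi_adj v : v \notin W :|: moved s -> adj E v (phi v).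
        rewrite inE negb_or => /andP[vW vS].
        by rewrite -hN //; apply: (routing_adj hW vW).
      apply/andP; split.
        apply/familyP=> v; rewrite -topredE /=; case: ifPn => [|/phi_adj //].
        rewrite inE; case: (boolP (v \in moved s)) => [/phiS -> //|vS].
        by rewrite orbF => vW; rewrite -hN // (routing_fix hW vW).
      apply/forall_inP=> v vX; have := vX; rewrite inE negb_or => /andP[vW vS].
      have := n2 v vW; rewrite (hN v vS); case: (boolP (phi v \in moved s)) => [pS|pS].
        by move=> _; rewrite (phiS _ pS) eq_sym;
          apply: (adj_neq E_simple (phi_adj v vX)).
      by rewrite (hN _ pS).
    case/andP=> phiX /forall_inP n2.
    have phi_fix v : (v \in W) || (v \in moved s) -> phi v = v.
      by move=> vX; apply: (routing_fix phiX); rewrite inE.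
    have phi_adj v : v \notin W -> v \notin moved s -> adj E v (phi v).
      by move=> vW vS; apply: (routing_adj phiX); rewrite inE negb_or vW.
    rewrite -!andbA; apply/and4P; split.
    - apply/familyP=> v; rewrite -topredE /= ffunE; case: (boolP (v \in moved s)) => vS.
        by rewrite (negbTE (notinW v vS)); apply: sadj.
      case: (boolP (v \in W)) => vW; last exact: phi_adj.
      by rewrite phi_fix ?vW.
    - apply/forall_inP=> v vW; rewrite !ffunE.
      case: (boolP (v \in moved s)) => vS; first by rewrite perm_moved vS s_no2.
      case: ifP => pS; last by apply: n2; rewrite inE negb_or vW.
      (* Here [phi v] is moved by [s]; its image under [s] is moved as well, hence is not [v]. *)
      by apply: contra vS => /eqP <-; rewrite perm_moved.
    - by apply/forall_inP=> v vS; rewrite ffunE vS.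
    - by apply/eqP/ffunP=> v; rewrite !ffunE;
      case: (boolP (v \in moved s)) => // vS; rewrite phi_fix ?vS ?orbT.
  rewrite -mulrA [LHS]mulrC; congr (_ * _).
  rewrite /weight (bigID (mem (moved s))) /=; congr (_ * _).
    apply: eq_big => [v|v /andP[_ vS]]; last by rewrite ffunE vS.
    by apply: andb_idl; apply: notinW.
  apply: eq_big => [v|v /andP[_ vS]]; first by rewrite in_setU negb_or.
  by rewrite ffunE (negbTE vS).
move=> phi s /andP[phiW /forall_inP n2] /forall_inP sphi.
have movedW v : v \in moved s -> v \notin W.
  move=> vS; apply/negP=> vW; move: (vS); rewrite inE.
  by rewrite (eqP (sphi v vS)) (routing_fix phiW vW) eqxx.
apply/and3P; split.
- apply/forall_inP=> v vS; have svS : s v \in moved s by rewrite perm_moved.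
  by rewrite (eqP (sphi _ svS)) (eqP (sphi v vS)) n2 ?movedW.
- apply/subsetP=> _ /imsetP[v vS ->]; rewrite (eqP (sphi v vS)).
  exact: (routing_adj phiW (movedW v vS)).
- by rewrite disjoint_subset; apply/subsetP=> v /movedW.
Qed.

(** * Matchings of the subdivision as maps without 2-cycles *)

Definition routing_matching X phi : {set {set V + {set V}}} :=
  [set [set inl v; inr [set v; phi v]] | v in ~: X].

Lemma subdiv_edge_inj (v w : V) (e d : {set V}) :
  [set inl v; inr e] = [set inl w; inr d] -> v = w /\ e = d.
Proof. by case/set2_eqP=> -[] // [->] [->]. Qed.

Lemma mem_subdiv_edge (u v : V) (e : {set V}) :
  ((inl u : V + {set V}) \in [set inl v; inr e]) = (u == v).
Proof. by rewrite !inE orbF. Qed.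

(** Only [v] outside [cover C] has to be required: an edge [e] of [C] containing [v] would put [v]
    in the cover. *)
Lemma deleted_subdivP C f : 
  reflect (exists v e, [/\ e \in E, v \in e, v \notin cover C & f = [set inl v; inr e]])
    (f \in delete_vertices (subdiv_edges E) (subdiv_vertices (cover C) C)).
Proof.
rewrite inE; apply: (iffP andP) => [[/imset2P[e v eE ve ->]]|[v [e [eE ve vC ->]]]].
  move=> dis; exists v, e; split=> //; apply: contraL dis => vC.
  apply/pred0Pn; exists (inl v); rewrite /= set21 inE.
  by apply/orP; left; apply: imset_f.
split; first by apply: imset2_f.
apply/pred0P=> z /=; apply/negP=> /andP[+ zA].
move: zA; rewrite !inE => /orP[]/imsetP[y yC ->] /orP[]/eqP // [yE].
  by rewrite -yE yC in vC.
by case/bigcupP: vC; exists e; rewrite // -yE.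
Qed.

Section FixedSubgraph.
Variable C : {set {set V}}.
Let Y := cover C.
Let F := delete_vertices (subdiv_edges E) (subdiv_vertices Y C).

Let uncovered (M : {set {set V + {set V}}}) := [set v | inl v \notin cover M].

Lemma routing_matchingP X phi : phi \in routing E X -> no2cycle X phi -> Y \subset X ->
  [/\ routing_matching X phi \subset F, trivIset (routing_matching X phi),
      (#|routing_matching X phi| = #|V| - #|X|)%N
    & uncovered (routing_matching X phi) = X].
Proof.
move=> phiX n2 /subsetP YX; have edge_inj := edge_inj n2; split.
- apply/subsetP=> f /imsetP[v vX ->]; apply/deleted_subdivP; exists v, [set v; phi v].
  rewrite inE in vX; split; rewrite ?set21 //; first exact: (routing_adj phiX vX).
  by apply: contra vX; apply: YX.
- apply/trivIsetP=> _ _ /imsetP[v vX ->] /imsetP[w wX ->] vw.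
  apply/pred0P=> z /=; apply/negP=> /andP[]; rewrite !inE.
  have {}vw : v != w by apply: contra vw => /eqP ->.
  case/orP=> /eqP -> /orP[]/eqP // [] => [vw'|]; first by rewrite vw' eqxx in vw.
  by move/(edge_inj v w vX wX) => vw'; rewrite vw' eqxx in vw.
- rewrite card_in_imset; first by rewrite -(cardsC X) addKn.
  by move=> v w _ _ /subdiv_edge_inj[].
- apply/setP=> v; rewrite inE; apply/idP/idP.
    apply: contraR => vX; apply/bigcupP; exists [set inl v; inr [set v; phi v]].
      by apply: imset_f; rewrite inE.
    exact: set21.
  apply: contraL => /bigcupP[_ /imsetP[w wX ->]]; rewrite mem_subdiv_edge => /eqP ->.
  by rewrite inE in wX.
Qed.

Lemma sub_uncovered (M : {set {set V + {set V}}}) : M \subset F ->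
  Y \subset uncovered M.
Proof.
move=> /subsetP MF; apply/subsetP=> v vY; rewrite inE; apply/negP=> /bigcupP[f fM].
have /deleted_subdivP[w [e [_ _ wY ->]]] := MF f fM.
by rewrite mem_subdiv_edge => /eqP vw; rewrite -vw vY in wY.
Qed.

Lemma routing_matching_inj X :
  {in [pred phi in routing E X] &, injective (routing_matching X)}.
Proof.
move=> phi psi phiX psiX eqM; apply/ffunP=> v.
case: (boolP (v \in X)) => vX; first by rewrite (routing_fix phiX vX) (routing_fix psiX vX).
have : [set inl v; inr [set v; phi v]] \in routing_matching X psi.
  by rewrite -eqM; apply: imset_f; rewrite inE.
case/imsetP=> w _ /subdiv_edge_inj[<-] /set2_eqP[[] //|[vE pE]].
by rewrite pE.
Qed.

(** If [v] is matched to [e^*], then [phi v] is the other endpoint of [e]. A 2-cycle would match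
    both endpoints of [e] to the same [e^*]. *)
Lemma matching_routing (M : {set {set V + {set V}}}) : M \subset F -> trivIset M ->
  exists2 phi, (phi \in routing E (uncovered M)) && no2cycle (uncovered M) phi
             & M = routing_matching (uncovered M) phi.
Proof.
move=> /subsetP MF /trivIsetP Mtriv; set X := uncovered M.
have M_eq z f g : f \in M -> g \in M -> z \in f -> z \in g -> f = g.
  move=> fM gM zf zg; apply/eqP; apply: contraT => fg.
  by have /pred0P/(_ z) := Mtriv f g fM gM fg; rewrite /= zf zg.
have MP f : f \in M -> exists v z,
    [/\ [set v; z] \in E, z != v, v \notin X & f = [set inl v; inr [set v; z]]].
  move=> fM; have /deleted_subdivP[v [e [eE ve _ fE]]] := MF f fM.
  have vX : v \notin X.
    by rewrite inE negbK; apply/bigcupP; exists f; rewrite // fE set21.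
  have /eqP/cards2P[a [b [ab eab]]] := E_simple eE.
  move: ve; rewrite eab !inE => /orP[]/eqP vE; subst v.
    by exists a, b; rewrite -eab eq_sym.
  by exists b, a; rewrite setUC -eab.
pose phi := [ffun v => odflt v
  [pick z | (z != v) && ([set inl v; inr [set v; z]] \in M)]].
have phi_in v : v \in X -> phi v = v.
  rewrite inE ffunE => vX; case: pickP => // z /andP[_ zM].
  by case/bigcupP: vX; exists [set inl v; inr [set v; z]]; rewrite ?set21.
have phi_out v : v \notin X ->
    phi v != v /\ [set inl v; inr [set v; phi v]] \in M.
  rewrite inE negbK ffunE => /bigcupP[f fM].
  have [w [z [_ zw _ fE]]] := MP f fM.
  rewrite fE mem_subdiv_edge => /eqP ->.
  by case: pickP => [y /andP[]|/(_ z)] //=; rewrite zw -fE fM.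
have ME : M = routing_matching X phi.
  apply/setP=> f; apply/idP/imsetP=> [fM|[v vX ->]]; last first.
    by have [] := phi_out v; rewrite // -in_setC.
  have [v [z [_ zv vX fE]]] := MP f fM; exists v; first by rewrite inE.
  by apply: (M_eq (inl v)); rewrite ?fE ?set21 -?fE //; have [] := phi_out v vX.
exists phi => //; apply/andP; split.
  apply/familyP=> v; rewrite -topredE /=; case: ifPn => [/phi_in -> //|/phi_out[_]].
  case/MP=> w [z [wzE _ _]] /subdiv_edge_inj[vw vzE].
  by rewrite /adj /= vzE.
apply/forall_inP=> v vX; have [pv fM] := phi_out v vX; apply/eqP=> ppv.
have pX : phi v \notin X by apply: contra pv => /phi_in ppv'; rewrite -{2}ppv ppv'.
have [_] := phi_out _ pX; rewrite ppv => gM.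
have : [set inl v; inr [set v; phi v]] = [set inl (phi v); inr [set phi v; v]].
  by apply: (M_eq (inr [set v; phi v])) => //; rewrite ?set22 // setUC set22.
by case/subdiv_edge_inj=> vE _; rewrite -vE eqxx in pv.
Qed.

Lemma matching_weight_no2 :
  matching_weight F (subdiv_weight c x) (#|V|%:Z - 2 - #|Y|%:Z)
    * \prod_(v | v \notin Y) x v =
  \sum_(W : {set V} | (#|W| == 2%N) && [disjoint Y & W])
    (\prod_(v in W) x v) * no2weight (W :|: Y).
Proof.
rewrite /matching_weight mulr_suml.
have card_Y (W : {set V}) : (#|W| == 2%N) && [disjoint Y & W] ->
  #|W :|: Y| = (2 + #|Y|)%N.
  case/andP=> /eqP W2 YW; rewrite cardsU W2 setIC disjoint_setI0 //.
  by rewrite cards0 subn0.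
(* Each edge of [M] covers exactly one vertex of [V], so the prescribed size leaves two vertices
   outside [Y] uncovered. *)
rewrite (partition_big (fun M => uncovered M :\: Y)
          (fun W : {set V} => (#|W| == 2%N) && [disjoint Y & W])) /=; last first.
  move=> M /and3P[MF Mtriv cardM].
  have YX := sub_uncovered MF.
  have [phi /andP[phiX n2] ME] := matching_routing MF Mtriv.
  have [_ _ cardE _] := routing_matchingP phiX n2 YX.
  rewrite disjoint_sym disjoints_subset subDset setUCr subsetT andbT.
  rewrite cardsD (setIidPr YX).
  have {}cardE : #|M| = (#|V| - #|uncovered M|)%N by rewrite {1}ME.
  move: cardM; rewrite cardE -subzn ?max_card // -addrA -opprD.
  rewrite (inj_eq (addrI _)) (inj_eq oppr_inj) -PoszD eqz_nat => /eqP ->.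
  by rewrite addnK.
apply: eq_bigr => W WP; have XE := card_Y W WP; case/andP: WP => W2 YW.
pose X := W :|: Y; have YX : Y \subset X by rewrite subsetUr.
have WX : X :\: Y = W.
  rewrite setDUl setDv setU0; apply/setDidPl; by rewrite disjoint_sym.
rewrite (eq_bigl (fun M => M \in routing_matching X @:
    [set phi | (phi \in routing E X) && no2cycle X phi])) => [|M]; last first.
  apply/andP/imsetP=> [[/and3P[MF Mtriv _] /eqP MW]|[phi]].
    have XM : uncovered M = X.
      rewrite /X -MW setUC setDE setUIr setUCr setIT.
      exact/esym/setUidPr/sub_uncovered.
    have [phi phiX ME] := matching_routing MF Mtriv; rewrite XM in phiX ME.
    by exists phi; rewrite ?in_set.
  rewrite in_set => /andP[phiX n2] ->.
  have [-> -> -> ->] := routing_matchingP phiX n2 YX; split; last by rewrite WX.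
  by rewrite -subzn ?max_card // XE PoszD opprD addrA eqxx.
rewrite big_imset /= => [|phi psi]; last first.
  by rewrite !in_set => /andP[p1 _] /andP[p2 _]; apply: routing_matching_inj.
rewrite /no2weight mulr_sumr.
apply: eq_big => [phi|phi]; rewrite in_set // => /andP[phiX n2].
rewrite big_imset /= => [|v w _ _ /subdiv_edge_inj[] //].
under eq_bigr do rewrite subdiv_weightE.
(* The factors [x v] with [v] in [W] survive; the others cancel the denominators of the weights
   [c e / x v]. *)
rewrite [X in _ * X = _](bigID (mem W)) /= mulrCA; congr (_ * _).
  apply: eq_bigl => v; apply: andb_idl => vW; by rewrite (disjointFl YW vW).
rewrite /weight (eq_bigl (fun v => v \notin X)) => [|v]; last by rewrite in_setC.
rewrite [X in _ * X](eq_bigl (fun v => v \notin X)) => [|v]; last first.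
  by rewrite in_setU negb_or andbC.
rewrite -big_split; apply: eq_bigr => v _ /=.
by rewrite divfK // lt0r_neq0.
Qed.

End FixedSubgraph.

Lemma sum_pairs (f : {set V} -> R) :
  \sum_u \sum_(v | (enum_rank u < enum_rank v)%N) f [set u; v]
    = \sum_(W : {set V} | #|W| == 2%N) f W.
Proof.
rewrite pair_big_dep /=.
rewrite [RHS](eq_bigl (fun W => W \in (fun p : V * V => [set p.1; p.2]) @:
    [set p : V * V | (enum_rank p.1 < enum_rank p.2)%N])) => [|W]; last first.
  apply/cards2P/imsetP=> [[a [b [ab ->]]]|[[a b]]].
    have : enum_rank a != enum_rank b by rewrite (inj_eq enum_rank_inj).
    rewrite -val_eqE /= neq_ltn => /orP[] lt_ab.
      by exists (a, b); rewrite ?inE.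
    by exists (b, a); rewrite ?inE //= setUC.
  rewrite inE /= => lt_ab ->; exists a, b; split=> //.
  by apply: contraTneq lt_ab => ->; rewrite ltnn.
rewrite big_imset /= => [|[a b] [a' b']]; first by apply: eq_bigl => p; rewrite inE.
rewrite !inE /= => ab ab' /set2_eqP[[-> ->] //|[aE bE]].
by move: ab'; rewrite -aE -bE ltnNge ltnW.
Qed.

End Injections.

Theorem theorem7p2 (R : realFieldType) (V : finType) (E : {set {set V}})
    (c : {set V} -> R) (x : V -> R)
    (E_simple : simple_graph E) (E_connected : connected_graph E)
    (c_gt0 : forall e, e \in E -> 0 < c e) (x_gt0 : forall v, 0 < x v) :
  kirchhoff_index E c x =
    (tree_weight E c)^-1 *
    (matching_weight (subdiv_edges E) (subdiv_weight c x) (#|V|%:Z - 2)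
       * \prod_(v : V) x v
     + \sum_(C in cycle_unions E)
         (- 2) ^+ num_components C * (\prod_(e in C) c e)
         * matching_weight
             (delete_vertices (subdiv_edges E) (subdiv_vertices (cover C) C))
             (subdiv_weight c x)
             (#|V|%:Z - 2 - #|cover C|%:Z)
         * \prod_(v : V | v \notin cover C) x v).
Proof.
transitivity ((tree_weight E c)^-1 *
    \sum_(W : {set V} | #|W| == 2%N)
      (\prod_(v in W) x v) * \det (fmatrix (laplacian E c W))).
  rewrite -sum_pairs mulr_sumr; apply: eq_bigr => u _; rewrite mulr_sumr.
  apply: eq_bigr => v uv; have {}uv : u != v by apply: contraTneq uv => ->;
    rewrite ltnn.
  by rewrite effective_resistanceE // big_setU1 ?inE //= big_set1 mulrCA.
congr (_ * _).
(* At the empty set [g] is the leading matching term, so that both parts of the formula have the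
   shape required by [sum_cycle_unions]. *)
pose g (C : {set {set V}}) := (\prod_(e in C) c e) * (matching_weight
             (delete_vertices (subdiv_edges E) (subdiv_vertices (cover C) C))
             (subdiv_weight c x) (#|V|%:Z - 2 - #|cover C|%:Z)
             * \prod_(v : V | v \notin cover C) x v).
have cover0 : cover (set0 : {set {set V}}) = set0 by rewrite /cover big_set0.
transitivity (g set0 + \sum_(C in cycle_unions E) (- 2) ^+ num_components C * g C);
  last first.
  congr (_ + _); last by apply: eq_bigr => C _; rewrite /g !mulrA.
  rewrite /g big_set0 mul1r cover0 cards0 subr0; congr (matching_weight _ _ _ * _).
    apply/setP=> f; rewrite inE; apply: andb_idr => _.
    by apply/pred0P=> z /=; rewrite !inE !imset0 !inE andbF.
  by apply: eq_bigl => v; rewrite inE.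
rewrite sum_cycle_unions.
under eq_bigr => W _ do rewrite det_laplacian_perm // mulr_sumr.
rewrite (exchange_big_dep (fun s => no2perm s && (perm_edges s \subset E))) /=;
  last first.
  by move=> W s _ /and3P[-> ->].
apply: eq_bigr => s /andP[s_no2 sE].
rewrite /g matching_weight_no2 // prod_perm_edges // cover_perm_edges mulrA mulr_sumr.
apply: eq_big => [W|W _]; first by rewrite s_no2 sE.
by rewrite mulrCA.
Qed.
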